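(* A $d$-dimensional $(0,1)$-matrix of order $2$ is extremal if and only if it is antipodal and contains no polydiagonal.
   Context: A $d$-dimensional matrix of order $2$ is an array $(a_\alpha)_{\alpha\in\{1,2\}^d}$; $\mathrm{supp}(A)=\{\alpha:a_\alpha\ne0\}$; the hyperplane $\Gamma_{i,j}$ is the set of indices with $\alpha_i=j$. For $\alpha\in\{1,2\}^d$ its antipodal index is $\overline\alpha$ with $\overline\alpha_i=3-\alpha_i$ for all $i$. A $(0,1)$-matrix $A$ of order $2$ is antipodal if $a_\alpha\ne a_{\overline\alpha}$ for every $\alpha$. A polyplex of weight $W$ is a nonnegative matrix $K$ whose entries sum to at most $1$ over each hyperplane and to $W$ in total; a polydiagonal in a matrix of order $2$ is a polyplex of weight $2$. A $(0,1)$-matrix $A$ contains $K$ if $\mathrm{supp}(K)\subseteq\mathrm{supp}(A)$. A $(0,1)$-matrix $A$ is extremal if it contains no polydiagonal, but for every $\alpha$ with $a_\alpha=0$ the matrix obtained by changing $a_\alpha$ to $1$ contains a polydiagonal. *)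

(* Defs.v *)
From mathcomp Require Import all_boot all_order all_algebra.
From mathcomp Require Import reals.

Set Implicit Arguments.
Unset Strict Implicit.
Unset Printing Implicit Defensive.

Import Order.TTheory GRing.Theory Num.Theory.
Local Open Scope ring_scope.

(* The coordinate values {1, 2} are encoded as the elements 0, 1 of 'I_2. *)
Definition multi_index (d : nat) := {ffun 'I_d -> 'I_2}.

Definition mat2 (R : realType) (d : nat) := {ffun multi_index d -> R}.

Definition supp (R : realType) (d : nat) (A : mat2 R d) : {set multi_index d} :=
  [set a | A a != 0].

Definition hyperplane (d : nat) (i : 'I_d) (j : 'I_2) : {set multi_index d} :=
  [set a : multi_index d | a i == j].

(* rev_ord on 'I_2 is k |-> 1 - k, i.e. j |-> 3 - j on {1, 2}. *)
Definition antipode (d : nat) (a : multi_index d) : multi_index d :=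
  [ffun i => rev_ord (a i)].

Definition zero_one (R : realType) (d : nat) (A : mat2 R d) : Prop :=
  forall a, A a = 0 \/ A a = 1.

Definition antipodal (R : realType) (d : nat) (A : mat2 R d) : Prop :=
  forall a, A a <> A (antipode a).

Definition polyplex (R : realType) (d : nat) (W : R) (K : mat2 R d) : Prop :=
  [/\ forall a, 0 <= K a,
      forall i j, \sum_(a in hyperplane i j) K a <= 1
    & \sum_a K a = W].

Definition polydiagonal (R : realType) (d : nat) (K : mat2 R d) : Prop :=
  polyplex 2 K.

Definition contains (R : realType) (d : nat) (A K : mat2 R d) : Prop :=
  supp K \subset supp A.

Definition contains_polydiagonal (R : realType) (d : nat) (A : mat2 R d) :
    Prop :=
  exists2 K : mat2 R d, polydiagonal K & contains A K.

Definition set_one (R : realType) (d : nat) (A : mat2 R d) (a : multi_index d) :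
    mat2 R d :=
  [ffun b => if b == a then 1 else A b].

(* Only meaningful for A satisfying zero_one, as is antipodal. *)
Definition extremal (R : realType) (d : nat) (A : mat2 R d) : Prop :=
  ~ contains_polydiagonal A /\
  forall a, A a = 0 -> contains_polydiagonal (set_one A a).

(* Main.v *)
Require Import Defs.
From mathcomp Require Import all_boot all_order all_algebra.
From mathcomp Require Import reals.
From mathcomp Require Import ring lra.

(** The indicator of an antipodal pair is a polydiagonal, so a matrix without
    polydiagonals cannot have ones at both ends of a pair.  If an extremal [A]
    vanished at both [a] and its antipode [a'], take polydiagonals [K], [L] in
    [A] completed at [a], respectively at [a'], with [t = K a > 0] and
    [s = L a' > 0].  Then [s K + t L - s t D], with [D] the indicator of
    [{a, a'}], vanishes at [a] and [a'] and has hyperplane sums at most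
    [s + t - s t > 0], hence rescales to a polydiagonal in [A]. *)

Set Implicit Arguments.
Unset Strict Implicit.
Unset Printing Implicit Defensive.

Import Order.TTheory GRing.Theory Num.Theory.
Local Open Scope ring_scope.

Lemma antipodeK (d : nat) : involutive (@antipode d).
Proof. by move=> a; apply/ffunP => i; rewrite !ffunE rev_ordK. Qed.

(** Reversal swaps the two values of ['I_2]. Hence every hyperplane meets an antipodal pair in
    exactly one index. *)
Lemma antipode_hyperplane (d : nat) (a : multi_index d) (i : 'I_d) (j : 'I_2) :
  (antipode a \in hyperplane i j) = (a \notin hyperplane i j).
Proof.
by rewrite !inE ffunE; move: (a i) j; do 2![case; case=> [|[|//]] ?].
Qed.

Lemma antipode_neq (d : nat) (a : multi_index d) : (0 < d)%N -> antipode a != a.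
Proof.
move=> d_gt0; apply/eqP.
move=> /(congr1 (fun b => b \in hyperplane (Ordinal d_gt0) 0)).
by rewrite antipode_hyperplane; case: (a \in _).
Qed.

(* In dimension 0 the index is its own antipode and the entry is 2. *)
Definition antipodal_pair (R : realType) (d : nat) (a : multi_index d) :
    mat2 R d :=
  [ffun b => (b == a)%:R + (b == antipode a)%:R].

Lemma sum_indicator (R : realType) (I : finType) (P : pred I) (a : I) :
  \sum_(b | P b) (b == a)%:R = (P a)%:R :> R.
Proof.
rewrite big_mkcond (bigD1 a) //= eqxx big1 ?addr0; first by case: (P a).
by move=> b /negbTE->; case: (P b).
Qed.

Lemma sum_hyperplane_antipodal_pair (R : realType) (d : nat)
    (a : multi_index d) (i : 'I_d) (j : 'I_2) :
  \sum_(b in hyperplane i j) antipodal_pair R a b = 1.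
Proof.
under eq_bigr do rewrite ffunE.
rewrite big_split !sum_indicator antipode_hyperplane.
by case: (a \in _); rewrite /= ?addr0 ?add0r.
Qed.

Lemma sum_antipodal_pair (R : realType) (d : nat) (a : multi_index d) :
  \sum_b antipodal_pair R a b = 2.
Proof. by under eq_bigr do rewrite ffunE; rewrite big_split !sum_indicator. Qed.

Lemma polydiagonal_antipodal_pair (R : realType) (d : nat)
    (a : multi_index d) : polydiagonal (antipodal_pair R a).
Proof.
split=> [b|i j|]; first by rewrite ffunE addr_ge0.
  by rewrite sum_hyperplane_antipodal_pair.
exact: sum_antipodal_pair.
Qed.

Lemma contains_polydiagonal_antipodal_pair (R : realType) (d : nat)
    (A : mat2 R d) (a : multi_index d) :
  A a != 0 -> A (antipode a) != 0 -> contains_polydiagonal A.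
Proof.
move=> Aa Aa'; exists (antipodal_pair R a).
  exact: polydiagonal_antipodal_pair.
apply/subsetP => b; rewrite !inE ffunE.
have [->//|_] := eqVneq b a; have [->//|_] := eqVneq b (antipode a).
by rewrite addr0 eqxx.
Qed.

(** Positive dimension supplies a hyperplane through [a], whose sum dominates the entry. *)
Lemma polydiagonal_le1 (R : realType) (d : nat) (K : mat2 R d)
    (a : multi_index d) : (0 < d)%N -> polydiagonal K -> K a <= 1.
Proof.
move=> d_gt0 [K_ge0 K_le1 _]; pose i := Ordinal d_gt0.
apply: le_trans (K_le1 i (a i)).
by rewrite (bigD1 a) ?inE //= lerDl sumr_ge0.
Qed.

Lemma contains_set_one_eq0 (R : realType) (d : nat) (A K : mat2 R d)
    (a b : multi_index d) :
  contains (set_one A a) K -> b != a -> A b = 0 -> K b = 0.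
Proof.
move=> /subsetP sKA ba Ab; apply/eqP/negPn/negP => Kb.
by have := sKA b; rewrite !inE ffunE (negbTE ba) Ab eqxx => /(_ Kb).
Qed.

Lemma contains_set_one (R : realType) (d : nat) (A K : mat2 R d)
    (a : multi_index d) :
  contains (set_one A a) K -> K a = 0 -> contains A K.
Proof.
move=> sKA Ka; apply/subsetP => b; rewrite !inE; apply: contraNneq => Ab.
have [->|ba] := eqVneq b a; first by rewrite Ka.
by rewrite (contains_set_one_eq0 sKA).
Qed.

Lemma contains_polydiagonal_glue (R : realType) (d : nat) (A : mat2 R d)
    (a : multi_index d) :
  (0 < d)%N -> A a = 0 -> A (antipode a) = 0 ->
  contains_polydiagonal (set_one A a) ->
  contains_polydiagonal (set_one A (antipode a)) ->
  contains_polydiagonal A.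
Proof.
move=> d_gt0 Aa Aa' [K pK sK] [L pL sL].
have a'a := antipode_neq a d_gt0.
(* A completion that vanishes at its added index already lies in [A]; otherwise [t] and [s] are
   positive. *)
have [Ka|Ka] := eqVneq (K a) 0.
  by exists K; last exact: contains_set_one Ka.
have [La'|La'] := eqVneq (L (antipode a)) 0.
  by exists L; last exact: contains_set_one La'.
have t_le1 := polydiagonal_le1 a d_gt0 pK.
have s_le1 := polydiagonal_le1 (antipode a) d_gt0 pL.
have Ka' := contains_set_one_eq0 sK a'a Aa'.
have La : L a = 0 by apply: (contains_set_one_eq0 sL) => //; rewrite eq_sym.
have [K_ge0 K_le1 K_sum] := pK; have [L_ge0 L_le1 L_sum] := pL.
have t_gt0 : 0 < K a by rewrite lt_def Ka K_ge0.
have s_gt0 : 0 < L (antipode a) by rewrite lt_def La' L_ge0.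
set t := K a in t_gt0 t_le1; set s := L (antipode a) in s_gt0 s_le1.
pose D := antipodal_pair R a.
(* Positivity is seen from [w = s + t * (1 - s)] with [0 < s <= 1] and [0 < t]. *)
pose w := s + t - s * t; have w_gt0 : 0 < w by rewrite /w; nra.
have [t_ge0 s_ge0 w_ge0] : [/\ 0 <= t, 0 <= s & 0 <= w] by rewrite !ltW.
pose M : mat2 R d := [ffun b => (s * K b + t * L b - s * t * D b) / w].
have sumM (P : pred (multi_index d)) : \sum_(b | P b) M b =
    (s * (\sum_(b | P b) K b) + t * (\sum_(b | P b) L b)
     - s * t * (\sum_(b | P b) D b)) / w.
  under eq_bigr do rewrite ffunE.
  by rewrite -mulr_suml sumrB big_split -!mulr_sumr.
(* At [a] only [K] contributes, with [s * t], and at the antipode only [L], with [t * s]; the term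
   in [D] cancels both. *)
have M0 b : (b == a) || (b == antipode a) -> M b = 0.
  rewrite ffunE /D ffunE => /orP[] /eqP->; rewrite eqxx.
    rewrite [a == _]eq_sym (negbTE a'a) La -/t.
    by rewrite mulr0 !addr0 mulr1 subrr mul0r.
  by rewrite (negbTE a'a) Ka' -/s mulr0 !add0r mulr1 [t * s]mulrC subrr mul0r.
have M1 b : ~~ ((b == a) || (b == antipode a)) -> M b = (s * K b + t * L b) / w.
  rewrite ffunE /D ffunE => /norP[/negbTE-> /negbTE->].
  by rewrite addr0 mulr0 subr0.
exists M.
  split=> [b|i j|].
  - case: (boolP ((b == a) || (b == antipode a))) => [/M0-> //|/M1->].
    by apply: divr_ge0 => //; apply: addr_ge0; apply: mulr_ge0.
  (* Since [D] sums to exactly 1 on each hyperplane, subtracting it lowers the bound [s + t] to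
     [w]. *)
  - rewrite sumM sum_hyperplane_antipodal_pair ler_pdivrMr // mul1r mulr1.
    by apply: lerB => //; apply: lerD; apply: ler_piMr.
  (* All three matrices have total 2, so the numerators of [M] add up to [2 * w]. *)
  - rewrite sumM K_sum L_sum sum_antipodal_pair /w; field.
    by rewrite gt_eqF.
apply/subsetP => b; rewrite !inE; apply: contraNneq => Ab.
case: (boolP ((b == a) || (b == antipode a))) => [/M0-> //|nb].
rewrite M1 //; case/norP: nb => ba ba'.
rewrite (contains_set_one_eq0 sK) // (contains_set_one_eq0 sL) //.
by rewrite !mulr0 addr0 mul0r.
Qed.

Theorem theorem8p1 (R : realType) (d : nat) (d_gt0 : (0 < d)%N)
    (A : mat2 R d) (A01 : zero_one A) :
  extremal A <-> antipodal A /\ ~ contains_polydiagonal A.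
Proof.
split=> [[noA maxA]|[antiA noA]]; split=> // a.
  (* Equal entries at an antipodal pair are both 0, excluded by gluing, or both 1, excluded by the
     indicator of the pair. *)
  move=> Aaa'; case: (A01 a) => Aa.
    have Aa' : A (antipode a) = 0 by rewrite -Aaa'.
    by apply: noA; apply: (contains_polydiagonal_glue d_gt0 Aa Aa'); apply: maxA.
  by apply/noA/(@contains_polydiagonal_antipodal_pair _ _ _ a);
    rewrite -?Aaa' Aa oner_neq0.
(* The antipode of a zero carries a nonzero entry, so filling the zero completes the pair. *)
move=> Aa; apply: (@contains_polydiagonal_antipodal_pair _ _ _ a).
  by rewrite ffunE eqxx oner_neq0.
rewrite ffunE (negbTE (antipode_neq a d_gt0)).
by apply/eqP => Aa'; apply: (antiA a); rewrite Aa Aa'.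
Qed.
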